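(* Let $(L,\otimes,u)$ be a commutative unital quantale. The category $L\text{-}\mathbf{IGCS}$ of interpolative generalized $L$-closure spaces with approximable $L$-relations as morphisms is equivalent to the category $L\text{-}\mathbf{CDOM}$ of continuous $L$-dcpos with Scott continuous mappings; and the category $L\text{-}\mathbf{CS}$ (the full subcategory of $L\text{-}\mathbf{IGCS}$ consisting of the $L$-closure spaces) is equivalent to the category $L\text{-}\mathbf{AlgDOM}$ (the full subcategory of $L\text{-}\mathbf{CDOM}$ consisting of the algebraic $L$-dcpos).
   Context: Quantale: $(L,\otimes,u)$ is a complete lattice with bottom $0$ and top $1$, with an associative commutative operation $\otimes$ with unit $u$, distributing over arbitrary joins; $\to$ is its residuation, i.e. $a\otimes b\le c\iff a\le b\to c$. An $L$-subset of $X$ is a map $A:X\to L$; $L^X$ is ordered pointwise. For $x\in X$, $u_x\in L^X$ is given by $u_x(x)=u$ and $u_x(y)=0$ for $y\ne x$. $\mathrm{sub}(A,B)=\bigwedge_{x\in X}(A(x)\to B(x))$. For $f:X\to Y$, $f^\rightarrow:L^X\to L^Y$ is $f^\rightarrow(A)(y)=\bigvee_{f(x)=y}A(x)$. $L$-orders: an $L$-ordered set is a set $P$ with $e:P\times P\to L$ such that $e(x,x)\ge u$; $e(x,y)\otimes e(y,z)\le e(x,z)$; and $e(x,y)\wedge e(y,x)\ge u$ implies $x=y$. An element $x_0$ is the supremum $\sqcup A$ of $A\in L^P$ if $e(x_0,y)=\bigwedge_{x\in P}(A(x)\to e(x,y))$ for all $y\in P$. $D\in L^P$ is directed if $\bigvee_{x\in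 P}D(x)\ge u$ and $D(x)\otimes D(y)\le\bigvee_{z\in P}D(z)\otimes e(x,z)\otimes e(y,z)$ for all $x,y$. $D\in L^P$ is a lower set if $D(x)\otimes e(y,x)\le D(y)$ for all $x,y$; an ideal is a directed lower set; $\mathcal{I}_L(P)$ is the set of ideals. $P$ is an $L$-dcpo if every directed $L$-subset has a supremum. A map $f:P\to Q$ is Scott continuous if $f(\sqcup D)=\sqcup f^\rightarrow(D)$ for every directed $D\in L^P$. For an $L$-dcpo $P$, define $\Downarrow x\in L^P$ by $\Downarrow x(y)=\bigwedge_{I\in\mathcal{I}_L(P)}(e(x,\sqcup I)\to I(y))$. An $L$-dcpo $P$ is continuous if for every $x\in P$, $\Downarrow x$ is directed and $\sqcup\Downarrow x=x$. An element $x$ is compact if $\Downarrow x(x)\ge u$; $K(P)$ is the set of compact elements; $k(x)\in L^P$ is given by $k(x)(y)=e(y,x)$ for $y\in K(P)$ and $0$ otherwise. An $L$-dcpo $P$ is algebraic if for every $x\in P$, $k(x)$ is directed and $\sqcup k(x)=x$. Closure spaces: a generalized $L$-closure space $(X,\langle\cdot\rangle)$ is a set $X$ with $\langle\cdot\rangle:L^X\to L^X$ such that $\mathrm{sub}(A,B)\le\mathrm{sub}(\langle A\rangle,\langle B\rangle)$ and $\langle\langle A\rangle\rangle\le\langle A\rangle$ for all $A,B\in L^X$. It is interpolative if for all $x,y,a,b\in X$: $\bigvee_{t\in X}\langle u_x\rangle(t)\ge u$; $\langle u_x\rangle(y)\le\bigvee_{t\in X}\langle u_x\rangle(t)\otimes\langle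 u_t\rangle(y)$; $\langle u_x\rangle(a)\otimes\langle u_x\rangle(b)\le\bigvee_{t\in X}\langle u_x\rangle(t)\otimes\langle u_t\rangle(a)\otimes\langle u_t\rangle(b)$. An $L$-closure space is a generalized $L$-closure space with moreover $A\le\langle A\rangle$ (hence $\langle\langle A\rangle\rangle=\langle A\rangle$) for all $A\in L^X$; every $L$-closure space is interpolative. Approximable $L$-relations: for interpolative generalized $L$-closure spaces $X,Y$, an approximable $L$-relation (also called $L$-approximable relation) from $X$ to $Y$ is $\Theta\in L^{X\times Y}$ such that for all $x,x'\in X$, $y,y',y_1,y_2\in Y$: (AP1) $\bigvee_{y\in Y}\Theta(x,y)\ge u$; (AP2) $\langle u_{x'}\rangle(x)\otimes\Theta(x,y)\le\Theta(x',y)$; (AP3) $\Theta(x,y)\otimes\langle u_y\rangle(y')\le\Theta(x,y')$; (AP4) $\Theta(x,y)\le\bigvee_{x'\in X,y'\in Y}\langle u_x\rangle(x')\otimes\Theta(x',y')\otimes\langle u_{y'}\rangle(y)$; (AP5) $\Theta(x,y_1)\otimes\Theta(x,y_2)\le\bigvee_{y_3\in Y}\Theta(x,y_3)\otimes\langle u_{y_3}\rangle(y_1)\otimes\langle u_{y_3}\rangle(y_2)$. The composition of $\Theta\in L^{X\times Y}$ and $\Upsilon\in L^{Y\times Z}$ is $\Upsilon\circ\Theta(x,z)=\bigvee_{y\in Y}\Theta(x,y)\otimes\Upsilon(y,z)$, and the identity on $X$ is $id_X(x,y)=\langle u_x\rangle(y)$. *)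

(* Defs.v *)
From HB Require Import structures.
From mathcomp Require Import all_boot all_order.
From mathcomp Require Import boolp classical_sets.

Set Implicit Arguments.
Unset Strict Implicit.
Unset Printing Implicit Defensive.
Import Order.TTheory.
Local Open Scope classical_set_scope.
Local Open Scope order_scope.

(** Completeness is an operation [qsup] on all subsets;
    [\bot], [\top] and [`&`] are those of the underlying lattice. *)

HB.mixin Record isQuantale d (L : Type) of Order.TBLattice d L := {
  qsup : set L -> L;
  qsupP : forall A : set L, isLub A (qsup A);
  qmul : L -> L -> L;
  qunit : L;
  qmulA : associative qmul;
  qmulC : commutative qmul;
  qmul1q : left_id qunit qmul;
  qmul_sup : forall (a : L) (A : set L),
    qmul a (qsup A) = qsup [set qmul a b | b in A]
}.

#[short(type="quantaleType")]
HB.structure Definition Quantale d :=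
  {L of isQuantale d L & Order.TBLattice d L}.

Declare Scope quantale_scope.
Delimit Scope quantale_scope with Q.
Local Open Scope quantale_scope.

Notation "a ⊗ b" := (qmul a b)
  (at level 40, left associativity) : quantale_scope.
Notation "⋁_ x F" := (qsup (range (fun x => F)))
  (at level 41, x at level 0, F at level 41, right associativity)
  : quantale_scope.

Section QuantaleOps.
Context {d : Order.disp_t} {L : quantaleType d}.

Definition qinf (A : set L) : L := qsup (lbound A).

Definition qres (b c : L) : L := qsup [set a | a ⊗ b <= c].

End QuantaleOps.

Notation "a ⇒ b" := (qres a b)
  (at level 55, right associativity) : quantale_scope.
Notation "⋀_ x F" := (qinf (range (fun x => F)))
  (at level 41, x at level 0, F at level 41, right associativity)
  : quantale_scope.

Section QuantaleTheory.
Context {d : Order.disp_t} {L : quantaleType d}.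
Implicit Types (a b c : L) (A : set L).

Lemma qsup_ub A a : A a -> a <= qsup A.
Proof. by have [ubA _] := qsupP A; exact: ubA. Qed.

Lemma qsup_le A b : (forall a, A a -> a <= b) -> qsup A <= b.
Proof. by have [_ lubA] := qsupP A; exact: lubA. Qed.

Lemma qinfP A : lbound A (qinf A) /\ (forall b, lbound A b -> b <= qinf A).
Proof.
split=> [a Aa|b lb]; last exact: qsup_ub.
by apply: qsup_le => b; exact.
Qed.

Lemma qmulq1 : right_id (qunit : L) qmul.
Proof. by move=> a; rewrite qmulC qmul1q. Qed.

Lemma qsup_set2 a b : a <= b -> qsup [set a; b] = b.
Proof.
move=> ab; apply/eqP; rewrite eq_le; apply/andP; split.
  by apply: qsup_le => c [->|->].
by apply: qsup_ub; right.
Qed.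

Lemma qmul_le2l c a b : a <= b -> c ⊗ a <= c ⊗ b.
Proof.
move=> ab; rewrite -(qsup_set2 ab) qmul_sup.
by apply: qsup_ub; exists a => //; left.
Qed.

Lemma qmul_le a b a' b' : a <= a' -> b <= b' -> a ⊗ b <= a' ⊗ b'.
Proof.
move=> aa' bb'; apply: le_trans (qmul_le2l a bb') _.
by rewrite ![_ ⊗ b']qmulC; exact: qmul_le2l.
Qed.

Lemma qresP a b c : (a ⊗ b <= c) = (a <= b ⇒ c).
Proof.
apply/idP/idP => [abc|ab]; first exact: qsup_ub.
apply: (le_trans (qmul_le ab (lexx b))).
rewrite qmulC qmul_sup; apply: qsup_le => _ [e /= ebc <-].
by rewrite qmulC.
Qed.

Lemma qbigsup_ub (I : Type) (F : I -> L) i : F i <= ⋁_i (F i).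
Proof. by apply: qsup_ub; exists i. Qed.

Lemma qbigsup_le (I : Type) (F : I -> L) b :
  (forall i, F i <= b) -> ⋁_i (F i) <= b.
Proof. by move=> Fb; apply: qsup_le => _ [i _ <-]. Qed.

Lemma qmul_bigsup (I : Type) a (F : I -> L) : a ⊗ (⋁_i (F i)) = ⋁_i (a ⊗ F i).
Proof. by rewrite qmul_sup image_comp. Qed.

End QuantaleTheory.

Section LSubsets.
Context {d : Order.disp_t} {L : quantaleType d}.

Definition lpoint (X : Type) (x : X) : X -> L :=
  fun y => if pselect (y = x) then qunit else \bot.

Definition lsub (X : Type) (A B : X -> L) : L := ⋀_x (A x ⇒ B x).

Definition limage (X Y : Type) (f : X -> Y) (A : X -> L) : Y -> L :=
  fun y => qsup [set A x | x in [set x | f x = y]].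

End LSubsets.

(** Morphisms are compared with Leibniz equality. *)

Record category := Category {
  obj : Type;
  hom : obj -> obj -> Type;
  idm : forall x, hom x x;
  compm : forall x y z, hom y z -> hom x y -> hom x z;
  comp1m : forall x y (f : hom x y), compm (idm y) f = f;
  compm1 : forall x y (f : hom x y), compm f (idm x) = f;
  compmA : forall x y z t (h : hom z t) (g : hom y z) (f : hom x y),
    compm h (compm g f) = compm (compm h g) f
}.
Arguments hom {c}.
Arguments idm {c}.
Arguments compm {c x y z}.

Definition full_subcat (C : category) (Q : obj C -> Prop) : category :=
  @Category {x : obj C | Q x} (fun x y => hom (sval x) (sval y))
    (fun x => idm (sval x)) (fun _ _ _ g f => compm g f)
    (fun _ _ f => comp1m f) (fun _ _ f => compm1 f)
    (fun _ _ _ _ h g f => compmA h g f).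

Record functor (C D : category) := Functor {
  fobj :> obj C -> obj D;
  fmap : forall x y, hom x y -> hom (fobj x) (fobj y);
  fmap_id : forall x, fmap (idm x) = idm (fobj x);
  fmap_comp : forall x y z (g : hom y z) (f : hom x y),
    fmap (compm g f) = compm (fmap g) (fmap f)
}.
Arguments fmap {C D} _ {x y}.

Definition functor_id (C : category) : functor C C :=
  @Functor C C id (fun _ _ f => f) (fun _ => erefl) (fun _ _ _ _ _ => erefl).

Lemma functor_comp_id (C D E : category) (G : functor D E) (F : functor C D) x :
  fmap G (fmap F (idm x)) = idm (G (F x)).
Proof. by rewrite !fmap_id. Qed.

Lemma functor_comp_comp (C D E : category) (G : functor D E) (F : functor C D)
    x y z (g : hom y z) (f : hom x y) :
  fmap G (fmap F (compm g f)) = compm (fmap G (fmap F g)) (fmap G (fmap F f)).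
Proof. by rewrite !fmap_comp. Qed.

Definition functor_comp (C D E : category) (G : functor D E) (F : functor C D) :
    functor C E :=
  @Functor C E (fun x => G (F x)) (fun _ _ f => fmap G (fmap F f))
    (functor_comp_id G F) (functor_comp_comp G F).

Definition naturally_isomorphic (C D : category) (F G : functor C D) : Prop :=
  exists (eta : forall x, hom (F x) (G x)) (eta' : forall x, hom (G x) (F x)),
    (forall x y (f : hom x y),
        compm (eta y) (fmap F f) = compm (fmap G f) (eta x)) /\
    (forall x, compm (eta' x) (eta x) = idm (F x) /\
               compm (eta x) (eta' x) = idm (G x)).

Definition equivalent_categories (C D : category) : Prop :=
  exists (F : functor C D) (G : functor D C),
    naturally_isomorphic (functor_comp G F) (functor_id C) /\
    naturally_isomorphic (functor_comp F G) (functor_id D).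

Record lordered d (L : quantaleType d) := LOrdered {
  lcarrier :> Type;
  lrel : lcarrier -> lcarrier -> L;
  lrel_refl : forall x, qunit <= lrel x x;
  lrel_trans : forall x y z, lrel x y ⊗ lrel y z <= lrel x z;
  lrel_antisym : forall x y, qunit <= lrel x y `&` lrel y x -> x = y
}.

Section LOrder.
Context {d : Order.disp_t} {L : quantaleType d}.
Variable P : lordered L.
Local Notation e := (@lrel d L P).

Definition is_lsup (A : P -> L) (x0 : P) : Prop :=
  forall y, e x0 y = ⋀_x (A x ⇒ e x y).

Definition directed (D : P -> L) : Prop :=
  qunit <= ⋁_x (D x) /\
  forall x y, D x ⊗ D y <= ⋁_z (D z ⊗ e x z ⊗ e y z).

Definition lower_set (D : P -> L) : Prop :=
  forall x y, D x ⊗ e y x <= D y.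

Definition ideal (D : P -> L) : Prop := directed D /\ lower_set D.

Definition is_ldcpo : Prop :=
  forall D, directed D -> exists x, is_lsup D x.

(** Suprema are unique when they exist, so over an [L]-dcpo the pairs [(I, s)]
    below correspond exactly to the ideals [I], with [s] the supremum of [I]. *)
Definition way_below (x : P) : P -> L := fun y =>
  qinf [set a | exists (I : P -> L) (s : P),
          [/\ ideal I, is_lsup I s & a = (e x s ⇒ I y)]].

Definition is_continuous : Prop :=
  forall x, directed (way_below x) /\ is_lsup (way_below x) x.

Definition compact_elt (x : P) : Prop := qunit <= way_below x x.

Definition compact_below (x : P) : P -> L := fun y =>
  if pselect (compact_elt y) then e y x else \bot.

Definition is_algebraic : Prop :=
  forall x, directed (compact_below x) /\ is_lsup (compact_below x) x.

End LOrder.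

(** [limage f D] must have a supremum, and that supremum must be [f x], where
    [x] is the supremum of [D]. *)
Definition scott_continuous d (L : quantaleType d) (P Q : lordered L)
    (f : P -> Q) : Prop :=
  forall (D : P -> L) (x : P),
    directed D -> is_lsup D x -> is_lsup (limage f D) (f x).

Section ScottTheory.
Context {d : Order.disp_t} {L : quantaleType d}.
Implicit Types P Q R : lordered L.

Lemma limage_ub (X Y : Type) (f : X -> Y) (A : X -> L) x :
  A x <= limage f A (f x).
Proof. by apply: qsup_ub; exists x. Qed.

Lemma limage_le (X Y : Type) (f : X -> Y) (A : X -> L) (b : Y -> L) :
  (forall x, A x <= b (f x)) -> forall y, limage f A y <= b y.
Proof. by move=> Ab y; apply: qsup_le => _ [x <- <-]. Qed.

Lemma limage_id (X : Type) (A : X -> L) : limage id A = A.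
Proof.
apply/funext => x; apply/eqP; rewrite eq_le; apply/andP; split.
  exact: (limage_le (f := id)).
exact: (limage_ub id).
Qed.

Lemma limage_comp (X Y Z : Type) (g : Y -> Z) (f : X -> Y) (A : X -> L) :
  limage (g \o f) A = limage g (limage f A).
Proof.
apply/funext => z; apply/eqP; rewrite eq_le; apply/andP; split.
  apply: limage_le => x; apply: le_trans (limage_ub g _ _).
  exact: limage_ub.
apply: (limage_le (b := limage (g \o f) A)) => y.
apply: (limage_le (b := fun y => limage (g \o f) A (g y))) => x.
exact: (limage_ub (g \o f)).
Qed.

Lemma down_directed P (y : P) : directed (fun z => lrel z y).
Proof.
split=> [|a b].
  exact: le_trans (lrel_refl y) (qbigsup_ub (fun z => lrel z y) y).
apply: le_trans (qbigsup_ub _ y) => /=.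
apply: qmul_le => //; rewrite -[leLHS]qmul1q.
by apply: qmul_le => //; exact: lrel_refl.
Qed.

Lemma down_sup P (y : P) : is_lsup (fun z => lrel z y) y.
Proof.
move=> t; have [lb glb] := qinfP (range (fun z : P => lrel z y ⇒ lrel z t)).
apply/eqP; rewrite eq_le; apply/andP; split.
  apply: glb => _ [z _ <-]; rewrite -qresP qmulC; exact: lrel_trans.
apply: le_trans (lb _ (ex_intro2 _ _ y I erefl)) _.
rewrite -[leLHS]qmulq1; apply: le_trans (qmul_le (lexx _) (lrel_refl y)) _.
by rewrite qresP.
Qed.

Lemma is_lsup_ub P (A : P -> L) x y : is_lsup A x -> A y <= lrel y x.
Proof.
move=> /(_ x) Ax; rewrite -[A y]qmul1q qresP.
apply: le_trans (lrel_refl x) _; rewrite Ax.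
have [lb _] := qinfP (range (fun z : P => A z ⇒ lrel z x)).
by apply: lb; exists y.
Qed.

Lemma scott_mono P Q (f : P -> Q) : scott_continuous f ->
  forall x y, lrel x y <= lrel (f x) (f y).
Proof.
move=> sf x y; have := sf _ _ (down_directed y) (down_sup y).
move=> /(is_lsup_ub (f x)); apply: le_trans.
exact: (limage_ub f (fun z => lrel z y)).
Qed.

Lemma scott_directed P Q (f : P -> Q) (D : P -> L) :
  scott_continuous f -> directed D -> directed (limage f D).
Proof.
move=> sf [D1 D2]; split.
  apply: le_trans D1 _; apply: qbigsup_le => x.
  exact: le_trans (limage_ub f D x) (qbigsup_ub _ (f x)).
have D2' x y : D x ⊗ D y <= ⋁_z (limage f D z ⊗ lrel (f x) z ⊗ lrel (f y) z).
  apply: le_trans (D2 x y) _; apply: qbigsup_le => z.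
  apply: le_trans (qbigsup_ub _ (f z)).
  apply: qmul_le; last exact: scott_mono.
  by apply: qmul_le; [exact: limage_ub|exact: scott_mono].
move=> a b; rewrite {1}/limage qmulC qmul_sup.
apply: qsup_le => _ [_ [x <- <-] <-].
rewrite qmulC qmul_sup; apply: qsup_le => _ [_ [y <- <-] <-].
exact: D2'.
Qed.

Lemma scott_id P : scott_continuous (@id P).
Proof. by move=> D x _ Dx; rewrite limage_id. Qed.

Lemma scott_comp P Q R (g : Q -> R) (f : P -> Q) :
  scott_continuous g -> scott_continuous f -> scott_continuous (g \o f).
Proof.
move=> sg sf D x dD Dx; rewrite limage_comp.
by apply: sg; [exact: scott_directed|exact: sf].
Qed.

End ScottTheory.

Section DomainCategories.
Context {d : Order.disp_t} (L : quantaleType d).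

Definition ldcpo := {P : lordered L | is_ldcpo P}.

Definition scott_map (P Q : ldcpo) :=
  {f : sval P -> sval Q | scott_continuous f}.

Definition scott_map_id (P : ldcpo) : scott_map P P :=
  exist _ id (@scott_id _ _ (sval P)).

Definition scott_map_comp (P Q R : ldcpo) (g : scott_map Q R)
    (f : scott_map P Q) : scott_map P R :=
  exist _ (sval g \o sval f) (scott_comp (svalP g) (svalP f)).

Lemma scott_map_idl P Q (f : scott_map P Q) :
  scott_map_comp (scott_map_id Q) f = f.
Proof. by case: f => f sf; exact: eq_exist. Qed.

Lemma scott_map_idr P Q (f : scott_map P Q) :
  scott_map_comp f (scott_map_id P) = f.
Proof. by case: f => f sf; exact: eq_exist. Qed.

Lemma scott_map_assoc P Q R S (h : scott_map R S) (g : scott_map Q R)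
    (f : scott_map P Q) :
  scott_map_comp h (scott_map_comp g f) = scott_map_comp (scott_map_comp h g) f.
Proof. exact: eq_exist. Qed.

Definition LDCPO : category :=
  Category scott_map_idl scott_map_idr scott_map_assoc.

Definition LCDOM : category :=
  @full_subcat LDCPO (fun P => is_continuous (sval P)).

Definition LAlgDOM : category :=
  @full_subcat LCDOM (fun P => is_algebraic (sval (sval P))).

End DomainCategories.

Record gclosure_space d (L : quantaleType d) := GClosureSpace {
  gcarrier :> Type;
  lcl : (gcarrier -> L) -> gcarrier -> L;
  lcl_sub : forall A B, lsub A B <= lsub (lcl A) (lcl B);
  lcl_idem : forall A x, lcl (lcl A) x <= lcl A x
}.

Section ClosureSpaces.
Context {d : Order.disp_t} {L : quantaleType d}.
Implicit Types X Y Z : gclosure_space L.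

Local Notation "⟨u_ x ⟩" := (lcl (lpoint x)) (at level 0, x at level 0).

Record interpolative X : Prop := Interpolative {
  interp1 : forall x : X, qunit <= ⋁_t (⟨u_ x⟩ t);
  interp2 : forall x y : X, ⟨u_ x⟩ y <= ⋁_t (⟨u_ x⟩ t ⊗ ⟨u_ t⟩ y);
  interp3 : forall x a b : X,
    ⟨u_ x⟩ a ⊗ ⟨u_ x⟩ b <= ⋁_t (⟨u_ x⟩ t ⊗ ⟨u_ t⟩ a ⊗ ⟨u_ t⟩ b)
}.

Definition is_closure_space X : Prop := forall (A : X -> L) x, A x <= lcl A x.

Record approximable X Y (Θ : X -> Y -> L) : Prop := Approximable {
  ap1 : forall x, qunit <= ⋁_y (Θ x y);
  ap2 : forall x x' y, ⟨u_ x'⟩ x ⊗ Θ x y <= Θ x' y;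
  ap3 : forall x y y', Θ x y ⊗ ⟨u_ y⟩ y' <= Θ x y';
  ap4 : forall x y,
    Θ x y <= ⋁_x' ⋁_y' (⟨u_ x⟩ x' ⊗ Θ x' y' ⊗ ⟨u_ y'⟩ y);
  ap5 : forall x y1 y2,
    Θ x y1 ⊗ Θ x y2 <= ⋁_y3 (Θ x y3 ⊗ ⟨u_ y3⟩ y1 ⊗ ⟨u_ y3⟩ y2)
}.

Definition relid X : X -> X -> L := fun x y => ⟨u_ x⟩ y.

Definition relcomp (X Y Z : Type) (Υ : Y -> Z -> L) (Θ : X -> Y -> L) :
    X -> Z -> L :=
  fun x z => ⋁_y (Θ x y ⊗ Υ y z).

Lemma le_anti_eq (a b : L) : a <= b -> b <= a -> a = b.
Proof. by move=> ab ba; apply/eqP; rewrite eq_le ab. Qed.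

Lemma qbigsup_mul (I : Type) (F : I -> L) a : (⋁_i (F i)) ⊗ a = ⋁_i (F i ⊗ a).
Proof.
rewrite qmulC qmul_bigsup; congr qsup; apply: eq_imagel => i _.
exact: qmulC.
Qed.

Lemma lcl_point_trans X (x t y : X) : ⟨u_ x⟩ t ⊗ ⟨u_ t⟩ y <= ⟨u_ x⟩ y.
Proof.
rewrite qresP.
apply: (@le_trans _ _ (lsub (lpoint t) (lcl (lpoint x)))).
  have [_ glb] := qinfP (range (fun s => lpoint t s ⇒ ⟨u_ x⟩ s)).
  apply: glb => _ [s _ <-]; rewrite -qresP [lpoint t s]/lpoint.
  case: pselect => [st|_] /=; first by rewrite st qmulq1.
  have -> : \bot = qsup set0 :> L.
    by apply: le_anti_eq; [exact: le0x|apply: qsup_le].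
  by rewrite qmul_sup image_set0; apply: qsup_le.
apply: le_trans (lcl_sub _ _) _.
have [lb _] := qinfP (range (fun s => ⟨u_ t⟩ s ⇒ lcl (lcl (lpoint x)) s)).
apply: le_trans (lb _ (ex_intro2 _ _ y I erefl)) _.
rewrite -qresP; apply: le_trans (lcl_idem _ _).
by rewrite qresP.
Qed.

Lemma approximable_id X : interpolative X -> approximable (@relid X).
Proof.
move=> [i1 i2 i3]; rewrite /relid; split=> //.
- by move=> *; exact: lcl_point_trans.
- by move=> *; exact: lcl_point_trans.
move=> x y; apply: le_trans (i2 x y) _; apply: qbigsup_le => t.
apply: le_trans (qmul_le (i2 x t) (lexx _)) _.
rewrite qbigsup_mul; apply: qbigsup_le => s.
apply: le_trans (qbigsup_ub _ s).
exact: (qbigsup_ub (fun y' => ⟨u_ x⟩ s ⊗ ⟨u_ s⟩ y' ⊗ ⟨u_ y'⟩ y) t).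
Qed.

Lemma relcomp_idl X Y (Θ : X -> Y -> L) :
  approximable Θ -> relcomp (@relid Y) Θ = Θ.
Proof.
move=> aT; apply/funext => x; apply/funext => y; apply: le_anti_eq.
  by apply: qbigsup_le => y'; exact: ap3.
apply: le_trans (ap4 aT x y) _; apply: qbigsup_le => x'.
apply: qbigsup_le => y'; apply: le_trans (qbigsup_ub _ y').
by apply: qmul_le => //; exact: ap2.
Qed.

Lemma relcomp_idr X Y (Θ : X -> Y -> L) :
  approximable Θ -> relcomp Θ (@relid X) = Θ.
Proof.
move=> aT; apply/funext => x; apply/funext => y; apply: le_anti_eq.
  by apply: qbigsup_le => x'; exact: ap2.
apply: le_trans (ap4 aT x y) _; apply: qbigsup_le => x'.
apply: qbigsup_le => y'; apply: le_trans (qbigsup_ub _ x').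
by rewrite -qmulA; apply: qmul_le => //; exact: ap3.
Qed.

Lemma relcomp_assoc (X Y Z T : Type) (Ξ : Z -> T -> L) (Υ : Y -> Z -> L)
    (Θ : X -> Y -> L) :
  relcomp Ξ (relcomp Υ Θ) = relcomp (relcomp Ξ Υ) Θ.
Proof.
apply/funext => x; apply/funext => t; apply: le_anti_eq.
  apply: qbigsup_le => z; rewrite qbigsup_mul; apply: qbigsup_le => y.
  apply: le_trans (qbigsup_ub _ y); rewrite -qmulA.
  by apply: qmul_le => //; exact: (qbigsup_ub (fun z => Υ y z ⊗ Ξ z t)).
apply: qbigsup_le => y; rewrite qmul_bigsup; apply: qbigsup_le => z.
apply: le_trans (qbigsup_ub _ z); rewrite qmulA.
by apply: qmul_le => //; exact: (qbigsup_ub (fun y => Θ x y ⊗ Υ y z)).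
Qed.

Lemma approximable_comp X Y Z (Υ : Y -> Z -> L) (Θ : X -> Y -> L) :
  approximable Υ -> approximable Θ -> approximable (relcomp Υ Θ).
Proof.
move=> aU aT; split.
- move=> x; apply: le_trans (ap1 aT x) _; apply: qbigsup_le => y.
  rewrite -[Θ x y]qmulq1.
  apply: le_trans (qmul_le (lexx _) (ap1 aU y)) _.
  rewrite qmul_bigsup; apply: qbigsup_le => z.
  apply: le_trans (qbigsup_ub _ z).
  exact: (qbigsup_ub (fun y => Θ x y ⊗ Υ y z)).
- move=> x x' z; rewrite qmul_bigsup; apply: qbigsup_le => y.
  apply: le_trans (qbigsup_ub _ y).
  by rewrite qmulA; apply: qmul_le => //; exact: ap2.
- move=> x z z'; rewrite qbigsup_mul; apply: qbigsup_le => y.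
  apply: le_trans (qbigsup_ub _ y).
  by rewrite -qmulA; apply: qmul_le => //; exact: ap3.
- move=> x z; rewrite -{1}(relcomp_idr aT) -{1}(relcomp_idl aU).
  rewrite -relcomp_assoc relcomp_assoc.
  apply: qbigsup_le => y; rewrite qbigsup_mul; apply: qbigsup_le => x'.
  rewrite qmul_bigsup; apply: qbigsup_le => z'.
  apply: le_trans (qbigsup_ub _ x'); apply: le_trans (qbigsup_ub _ z').
  rewrite !qmulA; apply: qmul_le => //; rewrite -!qmulA.
  apply: qmul_le => //; exact: (qbigsup_ub (fun y => Θ x' y ⊗ Υ y z')).
- move=> x z1 z2; rewrite {1 2}/relcomp qbigsup_mul.
  apply: qbigsup_le => y1; rewrite qmul_bigsup; apply: qbigsup_le => y2.
  have -> : Θ x y1 ⊗ Υ y1 z1 ⊗ (Θ x y2 ⊗ Υ y2 z2) =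
            Θ x y1 ⊗ Θ x y2 ⊗ (Υ y1 z1 ⊗ Υ y2 z2).
    by rewrite -!qmulA; congr (_ ⊗ _); rewrite !qmulA [Υ y1 z1 ⊗ _]qmulC.
  apply: le_trans (qmul_le (ap5 aT x y1 y2) (lexx _)) _.
  rewrite qbigsup_mul; apply: qbigsup_le => y.
  have -> : Θ x y ⊗ ⟨u_ y⟩ y1 ⊗ ⟨u_ y⟩ y2 ⊗ (Υ y1 z1 ⊗ Υ y2 z2) =
      Θ x y ⊗ (⟨u_ y⟩ y1 ⊗ Υ y1 z1 ⊗ (⟨u_ y⟩ y2 ⊗ Υ y2 z2)).
    rewrite -!qmulA; congr (_ ⊗ (_ ⊗ _)).
    by rewrite !qmulA [⟨u_ y⟩ y2 ⊗ _]qmulC.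
  apply: le_trans (qmul_le (lexx _)
    (qmul_le (ap2 aU _ _ _) (ap2 aU _ _ _))) _.
  apply: le_trans (qmul_le (lexx _) (ap5 aU y z1 z2)) _.
  rewrite qmul_bigsup; apply: qbigsup_le => z.
  apply: le_trans (qbigsup_ub _ z); rewrite !qmulA.
  do 2 apply: qmul_le => //.
  exact: (qbigsup_ub (fun y => Θ x y ⊗ Υ y z)).
Qed.

End ClosureSpaces.

Section ClosureCategories.
Context {d : Order.disp_t} (L : quantaleType d).

Definition igcs := {X : gclosure_space L | interpolative X}.

Definition approx_rel (X Y : igcs) :=
  {Θ : sval X -> sval Y -> L | approximable Θ}.

Definition approx_rel_id (X : igcs) : approx_rel X X :=
  exist _ (@relid _ _ (sval X)) (approximable_id (svalP X)).

Definition approx_rel_comp (X Y Z : igcs) (Υ : approx_rel Y Z)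
    (Θ : approx_rel X Y) : approx_rel X Z :=
  exist _ (relcomp (sval Υ) (sval Θ))
    (approximable_comp (svalP Υ) (svalP Θ)).

Lemma approx_rel_idl X Y (Θ : approx_rel X Y) :
  approx_rel_comp (approx_rel_id Y) Θ = Θ.
Proof. by case: Θ => Θ aT; exact/eq_exist/relcomp_idl. Qed.

Lemma approx_rel_idr X Y (Θ : approx_rel X Y) :
  approx_rel_comp Θ (approx_rel_id X) = Θ.
Proof. by case: Θ => Θ aT; exact/eq_exist/relcomp_idr. Qed.

Lemma approx_rel_assoc X Y Z T (Ξ : approx_rel Z T) (Υ : approx_rel Y Z)
    (Θ : approx_rel X Y) :
  approx_rel_comp Ξ (approx_rel_comp Υ Θ) =
  approx_rel_comp (approx_rel_comp Ξ Υ) Θ.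
Proof. exact/eq_exist/relcomp_assoc. Qed.

Definition LIGCS : category :=
  Category approx_rel_idl approx_rel_idr approx_rel_assoc.

Definition LCS : category :=
  @full_subcat LIGCS (fun X => is_closure_space (sval X)).

End ClosureCategories.

(* Main.v *)
Require Import Defs.
From mathcomp Require Import all_boot all_order.
From mathcomp Require Import boolp classical_sets.

Set Implicit Arguments.
Unset Strict Implicit.
Unset Printing Implicit Defensive.
Import Order.TTheory.
Local Open Scope classical_set_scope.
Local Open Scope order_scope.
Local Open Scope quantale_scope.

(** Write r(x, y) for the closure of the point x evaluated at y. Morphisms of
    generalized closure spaces only see r, a transitive L-relation, and the
    interpolation axioms make (X, r) an abstract basis in the sense of domain
    theory. The equivalence is the completion of abstract bases by rounded
    ideals.

    The functor is hom(1, -) for the one-point space 1: an approximable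
    relation from 1 to X is the same as a rounded ideal of X, that is a map
    I : X -> L that is inhabited, closed under r, directed and rounded
    (I(y) is the join of the I(x) ⊗ r(x, y)). Morphisms act by composition, so
    functoriality is the category laws. Ordered by [lsub], rounded ideals form
    an L-dcpo [Idl X], where directed suprema are computed pointwise
    ([union_approximable], [union_fam_lsup]).

    Everything about continuity goes through bases. A family b of elements of
    an L-dcpo is a basis ([is_basis]) when every p is the directed supremum of
    the b(x) weighted by how far b(x) is way below p. A domain is continuous
    exactly when the identity family is a basis, and algebraic exactly when the
    family of all compact elements is one ([algebraicP]); any basis makes the
    domain continuous, and a basis of compact elements makes it algebraic.

    The principal ideals r(x, -) form a basis of [Idl X] ([principal_basis]),
    so [Idl X] is continuous; if X is a closure space then r(x, x) >= u, the
    principal ideals are compact, and [Idl X] is algebraic.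

    The functor is faithful because the value of a relation at a principal
    ideal r(x, -) is the row of the relation at x ([ideal_map_inj]). It is full
    because a Scott continuous map is determined by its values on the principal
    ideals, and these values are the rows of an approximable relation
    ([scott_principal], [ideal_map_surj]).

    It is essentially surjective because a domain P with basis b is isomorphic
    to the ideals of the index set of b with r(x, y) the degree to which b(y)
    is way below b(x): send p to the trace on b of what is way below p, and an
    ideal to its supremum ([Idl_basis_iso]). For continuous P take for b the
    identity; for algebraic P take the compact elements, whose space satisfies
    r(k, k) >= u and therefore is a closure space. *)
(** * Quantales *)

Section Quantale.
Context {d : Order.disp_t} {L : quantaleType d}.
Implicit Types a b c : L.

Lemma qmulCA a b c : a ⊗ (b ⊗ c) = b ⊗ (a ⊗ c).
Proof. by rewrite !qmulA (qmulC a). Qed.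

Lemma qmulAC a b c : a ⊗ b ⊗ c = a ⊗ c ⊗ b.
Proof. by rewrite -!qmulA (qmulC b). Qed.

Lemma qmulACA a b c e : a ⊗ b ⊗ (c ⊗ e) = a ⊗ c ⊗ (b ⊗ e).
Proof. by rewrite -!qmulA (qmulCA b). Qed.

Lemma qmul_pair a b c x y : a ⊗ b ⊗ c ⊗ (x ⊗ y) = a ⊗ (x ⊗ b ⊗ (y ⊗ c)).
Proof. by rewrite -!qmulA (qmulCA c) (qmulCA b) (qmulC c). Qed.

Lemma qmul_ler a b c : a <= b -> a ⊗ c <= b ⊗ c.
Proof. by move=> ab; exact: qmul_le. Qed.

Lemma le_qbigsup (I : Type) (F : I -> L) (i : I) c : c <= F i -> c <= ⋁_i (F i).
Proof. by move=> cF; exact: le_trans cF (qbigsup_ub F i). Qed.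
Arguments le_qbigsup {I F} i {c}.

Lemma qbigsup_mono (I : Type) (F G : I -> L) :
  (forall i, F i <= G i) -> ⋁_i (F i) <= ⋁_i (G i).
Proof. by move=> FG; apply: qbigsup_le => i; exact: le_qbigsup (FG i). Qed.

Lemma qbigsup_mul_le (I : Type) (F : I -> L) a c :
  (forall i, F i ⊗ a <= c) -> (⋁_i (F i)) ⊗ a <= c.
Proof. by move=> Fc; rewrite qbigsup_mul; exact: qbigsup_le. Qed.

Lemma qbigsup_mul2_le (I J : Type) (F : I -> L) (G : J -> L) c :
  (forall i j, F i ⊗ G j <= c) -> (⋁_i (F i)) ⊗ (⋁_j (G j)) <= c.
Proof.
move=> FGc; apply: qbigsup_mul_le => i; rewrite qmul_bigsup.
exact: qbigsup_le.
Qed.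

Lemma le_qbiginf (I : Type) (F : I -> L) c :
  (c <= ⋀_i (F i)) <-> (forall i, c <= F i).
Proof.
have [lb glb] := qinfP (range F); split=> [cF i|cF].
  by apply: le_trans cF _; apply: lb; exists i.
by apply: glb => _ [i _ <-].
Qed.

Lemma le_lsub (X : Type) (A B : X -> L) c :
  (c <= lsub A B) <-> (forall x, A x ⊗ c <= B x).
Proof.
rewrite /lsub le_qbiginf; split=> cAB x; first by rewrite qmulC qresP.
by rewrite -qresP qmulC.
Qed.

Lemma lsub_mp (X : Type) (A B : X -> L) x : A x ⊗ lsub A B <= B x.
Proof. by move: x; apply/le_lsub. Qed.

Lemma lsub_refl (X : Type) (A : X -> L) : qunit <= lsub A A.
Proof. by apply/le_lsub => x; rewrite qmulq1. Qed.

Lemma lsub_trans (X : Type) (A B C : X -> L) :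
  lsub A B ⊗ lsub B C <= lsub A C.
Proof.
apply/le_lsub => x; rewrite qmulA.
exact: le_trans (qmul_ler _ (lsub_mp _ _ _)) (lsub_mp _ _ _).
Qed.

Lemma lsub_unit (X : Type) (A B : X -> L) :
  qunit <= lsub A B -> forall x, A x <= B x.
Proof. by move=> /le_lsub AB x; rewrite -[A x]qmulq1. Qed.

Lemma qmul0q a : \bot ⊗ a = \bot.
Proof.
apply: le_anti_eq; last exact: le0x.
by rewrite qresP; exact: le0x.
Qed.

Lemma lpointxx (X : Type) (x : X) : lpoint x x = qunit :> L.
Proof. by rewrite /lpoint; case: pselect. Qed.

Lemma lpoint_sup (X : Type) (F : X -> L) (t : X) : ⋁_x (lpoint t x ⊗ F x) = F t.
Proof.
apply: le_anti_eq; last by apply: (le_qbigsup t); rewrite lpointxx qmul1q.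
apply: qbigsup_le => x; rewrite /lpoint; case: pselect => [xt|_] /=.
  by rewrite xt qmul1q.
by rewrite qmul0q; exact: le0x.
Qed.

End Quantale.
Arguments le_qbigsup {d L I F} i {c}.

Lemma sval_inj (T : Type) (Q : T -> Prop) : injective (@sval T Q).
Proof. by move=> [x Qx] [y Qy]; exact: eq_exist. Qed.

(** * Fully faithful and essentially surjective functors *)

(** The quasi-inverse sends Y to a chosen G(Y) with F(G(Y)) isomorphic to Y,
    and a morphism to the unique lift of its conjugate by these
    isomorphisms. *)
Lemma equivalence_of_fully_faithful (C D : category) (F : functor C D) :
  (forall x y (g : hom (F x) (F y)), exists f, fmap F f = g) ->
  (forall x y, injective (@fmap _ _ F x y)) ->
  (forall Y : obj D, exists X (i : hom (F X) Y) (j : hom Y (F X)),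
      compm j i = idm (F X) /\ compm i j = idm Y) ->
  equivalent_categories C D.
Proof.
move=> full faith surj.
pose G Y := sval (cid (surj Y)).
pose i Y : hom (F (G Y)) Y := sval (cid (svalP (cid (surj Y)))).
pose j Y : hom Y (F (G Y)) :=
  sval (cid (svalP (cid (svalP (cid (surj Y)))))).
have [ji ij] : (forall Y, compm (j Y) (i Y) = idm (F (G Y))) /\
    (forall Y, compm (i Y) (j Y) = idm Y).
  by split=> Y; have [] := svalP (cid (svalP (cid (svalP (cid (surj Y)))))).
pose lift x y g := sval (cid (full x y g)).
have liftK x y g : fmap F (lift x y g) = g by rewrite /lift; case: cid.
pose G1 X Y (f : hom X Y) := lift _ _ (compm (j Y) (compm f (i X))).
have G1id X : G1 X X (idm X) = idm (G X).
  by apply: (faith (G X) (G X)); rewrite liftK comp1m ji fmap_id.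
have G1comp X Y Z (g : hom Y Z) (f : hom X Y) :
    G1 X Z (compm g f) = compm (G1 Y Z g) (G1 X Y f).
  apply: (faith (G X) (G Z)); rewrite fmap_comp !liftK -!compmA; congr compm.
  by rewrite (compmA (i Y)) ij comp1m.
pose GF : functor D C := @Functor D C G G1 G1id G1comp.
exists F, GF; split.
  exists (fun x => lift (G (F x)) x (i (F x))).
  exists (fun x => lift x (G (F x)) (j (F x))); split=> [x y f|x].
    apply: (faith (G (F x)) y).
    by rewrite !fmap_comp !liftK (compmA (i (F y))) ij comp1m.
  split; first by apply: (faith (G (F x))); rewrite fmap_comp !liftK ji fmap_id.
  by apply: (faith x); rewrite fmap_comp !liftK ij fmap_id.
exists i, j; split=> [X Y f|X]; last by split; [exact: ji|exact: ij].
by rewrite /= liftK compmA ij comp1m.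
Qed.

(** * Families in an L-ordered set *)

Section Families.
Context {d : Order.disp_t} {L : quantaleType d}.
Variable P : lordered L.
Local Notation e := (@lrel d L P).
Implicit Types p q s : P.

(** Families b weighted by A replace the image [limage b A]: the two are
    directed together and have the same suprema ([directed_limage],
    [is_lsup_limage]), while a join over indices needs no join over fibres. For
    b the identity, the notions unfold to [directed] and [is_lsup]. *)
Definition fam_directed (X : Type) (b : X -> P) (A : X -> L) : Prop :=
  qunit <= ⋁_x (A x) /\
  forall x y, A x ⊗ A y <= ⋁_z (A z ⊗ e (b x) (b z) ⊗ e (b y) (b z)).

Definition fam_lsup (X : Type) (b : X -> P) (A : X -> L) (p : P) : Prop :=
  forall q, e p q = ⋀_x (A x ⇒ e (b x) q).

Lemma lrel_anti p q : qunit <= e p q -> qunit <= e q p -> p = q.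
Proof. by move=> pq qp; apply: lrel_antisym; rewrite lexI pq qp. Qed.

(** The universal property, free of residuals: p is an upper bound, and c is
    below e(p, q) as soon as q is an upper bound to the degree c. *)
Lemma fam_lsupP (X : Type) (b : X -> P) (A : X -> L) p :
  fam_lsup b A p <->
  (forall x, A x <= e (b x) p) /\
  (forall q c, (forall x, A x ⊗ c <= e (b x) q) -> c <= e p q).
Proof.
split=> [supp|[ub lub] q].
  split=> [x|q c Ac].
    have := lrel_refl p; rewrite supp => /le_qbiginf/(_ x).
    by rewrite -qresP qmul1q.
  by rewrite supp; apply/le_qbiginf => x; rewrite -qresP qmulC.
apply: le_anti_eq.
  apply/le_qbiginf => x; rewrite -qresP qmulC.
  exact: le_trans (qmul_ler _ (ub x)) (lrel_trans _ _ _).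
apply: lub => x; rewrite qmulC qresP.
by move: x; apply/le_qbiginf.
Qed.

Lemma fam_lsup_uniq (X : Type) (b : X -> P) (A : X -> L) p q :
  fam_lsup b A p -> fam_lsup b A q -> p = q.
Proof.
move=> pA qA; have eqpq t : e p t = e q t by rewrite pA qA.
by apply: lrel_anti; [rewrite eqpq|rewrite -eqpq]; exact: lrel_refl.
Qed.

Lemma is_lsup_limage (X : Type) (b : X -> P) (A : X -> L) p :
  is_lsup (limage b A) p <-> fam_lsup b A p.
Proof.
change (is_lsup (limage b A) p) with (fam_lsup id (limage b A) p).
rewrite !fam_lsupP; split=> -[ub lub]; split=> [x|q c Ac].
- exact: le_trans (limage_ub b A x) (ub _).
- apply: lub => y; rewrite qresP.
  apply: (limage_le (b := fun y => c ⇒ e y q)) => x.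
  by rewrite -qresP.
- exact: (limage_le (b := fun y => e y p)).
- apply: lub => x; apply: le_trans (Ac (b x)).
  exact/qmul_ler/limage_ub.
Qed.

Lemma directed_limage (X : Type) (b : X -> P) (A : X -> L) :
  directed (limage b A) <-> fam_directed b A.
Proof.
split=> -[D1 D2].
  split; first apply: le_trans D1 _.
    apply: qbigsup_le => y.
    by apply: (limage_le (b := fun=> _)) => x; exact: qbigsup_ub.
  move=> x y.
  apply: le_trans (qmul_le (limage_ub b A x) (limage_ub b A y)) _.
  apply: le_trans (D2 _ _) _; apply: qbigsup_le => p.
  rewrite -qmulA qresP.
  apply: (limage_le (b := fun p => e (b x) p ⊗ e (b y) p ⇒ _)) => z.
  by rewrite -qresP qmulA; exact: (le_qbigsup z).
split.
  apply: le_trans D1 _; apply: qbigsup_le => x.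
  exact: le_trans (limage_ub b A x) (qbigsup_ub _ (b x)).
move=> p q; rewrite qresP; apply: (limage_le (b := fun p => _ ⇒
  ⋁_z (limage b A z ⊗ e p z ⊗ e q z))) => x.
rewrite -qresP qmulC qresP; apply: (limage_le (b := fun q => _ ⇒
  ⋁_z (limage b A z ⊗ e (b x) z ⊗ e q z))) => y.
rewrite -qresP qmulC; apply: le_trans (D2 x y) _; apply: qbigsup_le => z.
by apply: (le_qbigsup (b z)); do 2 apply: qmul_ler; exact: limage_ub.
Qed.

(** The lower closure turns a directed family into an ideal with the same
    supremum. Ideals being what [way_below] quantifies over, this is how a
    directed family bounds the way-below relation from above. *)
Definition generated (X : Type) (b : X -> P) (A : X -> L) : P -> L :=
  fun y => ⋁_x (A x ⊗ e y (b x)).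

Lemma generated_lower (X : Type) (b : X -> P) (A : X -> L) :
  lower_set (generated b A).
Proof.
move=> x y; apply: qbigsup_mul_le => z; apply: (le_qbigsup z).
rewrite -qmulA; apply: qmul_le2l; rewrite qmulC; exact: lrel_trans.
Qed.

Lemma generated_ub (X : Type) (b : X -> P) (A : X -> L) x :
  A x <= generated b A (b x).
Proof.
apply: (le_qbigsup x); rewrite -[leLHS]qmulq1.
exact/qmul_le2l/lrel_refl.
Qed.

(** The bound is by the family itself and not by its lower closure. This
    sharper form matters because ⊗ need not be idempotent: once a weight
    e(y, b(z)) has been spent to replace an arbitrary upper bound by a member
    of the family, it cannot be used again for y'. *)
Lemma generated_directed (X : Type) (b : X -> P) (A : X -> L) y y' :
  fam_directed b A ->
  generated b A y ⊗ generated b A y' <= ⋁_z (A z ⊗ e y (b z) ⊗ e y' (b z)).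
Proof.
move=> [_ D2]; apply: qbigsup_mul2_le => x x'; rewrite qmulACA.
apply: le_trans (qmul_ler _ (D2 x x')) _.
apply: qbigsup_mul_le => z; apply: (le_qbigsup z).
rewrite -!qmulA; apply: qmul_le2l; rewrite [X in _ <= X]qmulC qmulA qmulACA qmulC.
by apply: qmul_le; rewrite qmulC; exact: lrel_trans.
Qed.

Lemma generated_ideal (X : Type) (b : X -> P) (A : X -> L) :
  fam_directed b A -> ideal (generated b A).
Proof.
move=> DA; split; last exact: generated_lower.
split=> [|y y'].
  have [D1 _] := DA; apply: le_trans D1 _; apply: qbigsup_le => x.
  by apply: (le_qbigsup (b x)); exact: generated_ub.
apply: le_trans (generated_directed _ _ DA) _.
apply: qbigsup_le => z; apply: (le_qbigsup (b z)).
by do 2 apply: qmul_ler; exact: generated_ub.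
Qed.

Lemma generated_lsup (X : Type) (b : X -> P) (A : X -> L) p :
  is_lsup (generated b A) p <-> fam_lsup b A p.
Proof.
change (is_lsup (generated b A) p) with (fam_lsup id (generated b A) p).
rewrite !fam_lsupP; split=> -[ub lub]; split=> [x|q c Ac].
- exact: le_trans (generated_ub b A x) (ub _).
- apply: lub => y; apply: qbigsup_mul_le => x.
  rewrite qmulAC qmulC; apply: le_trans (lrel_trans y (b x) q).
  exact: qmul_le2l.
- apply: qbigsup_le => y; rewrite qmulC; apply: le_trans (lrel_trans x (b y) p).
  exact: qmul_le2l.
- apply: lub => x; apply: le_trans (Ac (b x)).
  exact/qmul_ler/generated_ub.
Qed.

Lemma fam_lsup_exists (X : Type) (b : X -> P) (A : X -> L) :
  is_ldcpo P -> fam_directed b A -> exists s, fam_lsup b A s.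
Proof.
move=> dP /generated_ideal[/dP[s sA] _]; exists s; exact/generated_lsup.
Qed.

(** * The way-below relation and bases *)

Lemma way_below_le x y (I : P -> L) s :
  ideal I -> is_lsup I s -> way_below x y ⊗ e x s <= I y.
Proof.
move=> iI sI; rewrite qresP /way_below.
by have [lb _] := qinfP [set a | exists (I : P -> L) (s : P),
  [/\ ideal I, is_lsup I s & a = (e x s ⇒ I y)]]; apply: lb; exists I, s.
Qed.

Lemma le_way_below c x y :
  (forall (I : P -> L) s, ideal I -> is_lsup I s -> c ⊗ e x s <= I y) ->
  c <= way_below x y.
Proof.
move=> cI; have [_ glb] := qinfP [set a | exists (I : P -> L) (s : P),
  [/\ ideal I, is_lsup I s & a = (e x s ⇒ I y)]].
by apply: glb => _ [I [s [iI sI ->]]]; rewrite -qresP; exact: cI.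
Qed.

Lemma way_below_ideal (I : P -> L) x y :
  ideal I -> is_lsup I x -> way_below x y <= I y.
Proof.
move=> iI Ix; apply: le_trans (way_below_le x y iI Ix).
rewrite -[leLHS]qmulq1; exact/qmul_le2l/lrel_refl.
Qed.

(** The down set of x is itself an ideal with supremum x. *)
Lemma way_below_lrel x y : way_below x y <= e y x.
Proof.
apply: way_below_ideal (down_sup x); split; first exact: down_directed.
by move=> s t; rewrite qmulC; exact: lrel_trans.
Qed.

Lemma way_below_mono x x' y : way_below x y ⊗ e x x' <= way_below x' y.
Proof.
apply: le_way_below => I s iI sI; rewrite -qmulA.
apply: le_trans (way_below_le x y iI sI); apply: qmul_le2l; exact: lrel_trans.
Qed.

Lemma way_below_lower x y y' : way_below x y ⊗ e y' y <= way_below x y'.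
Proof.
apply: le_way_below => I s iI sI; rewrite qmulAC.
apply: le_trans (qmul_ler _ (way_below_le x y iI sI)) _.
by have [_] := iI; exact.
Qed.

Lemma way_below_trans (x y z : P) : way_below x y ⊗ way_below y z <= way_below x z.
Proof.
rewrite qmulC; apply: le_trans (way_below_mono y x z).
exact/qmul_le2l/way_below_lrel.
Qed.

(** Directedness is asked of the restricted weights themselves, not only that
    the b(x) be cofinal among the elements way below p: replacing a common upper
    bound v of two elements by some b(z) above it would use the weight e(v, b(z))
    twice, and ⊗ need not be idempotent. *)
Definition is_basis (X : Type) (b : X -> P) : Prop :=
  forall p, fam_directed b (way_below p \o b) /\
            fam_lsup b (way_below p \o b) p.

Lemma way_below_generated (X : Type) (b : X -> P) (A : X -> L) p y :
  fam_directed b A -> fam_lsup b A p -> way_below p y <= generated b A y.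
Proof.
move=> dA pA; apply: way_below_ideal; first exact: generated_ideal.
exact/generated_lsup.
Qed.

(** It suffices to approximate each p by some directed family of members of b
    that lie way below p: what is way below p is below the ideal generated by
    that family, so the remaining weights add nothing new. The reindexing h
    allows b to have more members than the approximating family; this one
    criterion serves the principal ideals, the family of all elements and the
    family of all compact elements. *)
Lemma basis_of_families (X Y : Type) (b : Y -> P) (h : X -> Y) :
  (forall p, exists A : X -> L,
    [/\ fam_directed (b \o h) A, fam_lsup (b \o h) A p &
        forall x, A x <= way_below p (b (h x))]) ->
  is_basis b.
Proof.
move=> approx p; have [A [dA pA Aw]] := approx p.
split; last first.
  apply/fam_lsupP; split=> [y|q c wc]; first exact: way_below_lrel.
  move/fam_lsupP: pA => [_]; apply=> x.
  by apply: le_trans (wc (h x)); exact: qmul_ler.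
split.
  have [D1 _] := dA; apply: le_trans D1 _; apply: qbigsup_le => x.
  exact: (le_qbigsup (h x)).
move=> y y'; apply: (@le_trans _ _ (generated (b \o h) A (b y) ⊗
    generated (b \o h) A (b y'))).
  by apply: qmul_le; exact: way_below_generated.
apply: le_trans (generated_directed _ _ dA) _.
apply: qbigsup_le => z; apply: (le_qbigsup (h z)).
by do 2 apply: qmul_ler; exact: Aw.
Qed.

Lemma basis_continuous (X : Type) (b : X -> P) :
  is_basis b -> is_continuous P.
Proof.
move=> bb; apply: (@basis_of_families X P id b) => p.
by have [] := bb p; exists (way_below p \o b).
Qed.

Lemma compact_rel p k : compact_elt k -> way_below p k = e k p.
Proof.
move=> ck; apply: le_anti_eq; first exact: way_below_lrel.
apply: le_trans (way_below_mono k p k); rewrite -[leLHS]qmul1q.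
exact: qmul_ler.
Qed.

(** By [compact_rel], the order and the way-below relation agree on the
    compact elements, so the weights defining algebraicity are those of a
    basis. *)
Lemma compact_belowE p : compact_below p =
  limage sval (fun k : {k : P | compact_elt k} => way_below p (sval k)).
Proof.
apply/funext => y; apply: le_anti_eq; rewrite /compact_below;
    case: pselect => [cy|ncy] /=.
- rewrite -compact_rel //; apply: qsup_ub.
  by exists (exist _ y cy).
- exact: le0x.
- apply: qsup_le => a [k /= ky wa]; rewrite -wa -ky; exact: way_below_lrel.
- by apply: qsup_le => a [[k ck] /= ky _]; rewrite -ky in ncy.
Qed.

Lemma algebraicP :
  is_algebraic P <-> is_basis (sval : {k : P | compact_elt k} -> P).
Proof.
split=> aP p; have := aP p; rewrite compact_belowE.
  by move=> [/directed_limage ? /is_lsup_limage ?].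
by move=> [? ?]; split; [exact/directed_limage|exact/is_lsup_limage].
Qed.

Lemma compact_basis_algebraic (X : Type) (b : X -> P) :
  is_basis b -> (forall x, compact_elt (b x)) -> is_algebraic P.
Proof.
move=> bb cb; apply/algebraicP.
apply: (@basis_of_families X _ sval (fun x => exist _ (b x) (cb x))) => p.
by have [] := bb p; exists (way_below p \o b).
Qed.

Section Basis.
Variables (X : Type) (b : X -> P).
Hypothesis bb : is_basis b.

(** The right-hand side is an ideal in y, and its supremum is p because it is
    the supremum of the suprema b(x) of what is way below them; p is then below
    that supremum, which bounds [way_below p]. *)
Lemma way_below_interpolate p y :
  way_below p y <= ⋁_x (way_below p (b x) ⊗ way_below (b x) y).
Proof.
have [dp sp] := bb p.
apply: (@way_below_ideal (fun y => ⋁_x (way_below p (b x) ⊗ way_below (b x) y))).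
  split; last first.
    move=> z t; apply: qbigsup_mul_le => x; apply: (le_qbigsup x).
    by rewrite -qmulA; apply: qmul_le2l; exact: way_below_lower.
  split.
    have [D1 _] := dp; apply: le_trans D1 _; apply: qbigsup_le => x.
    rewrite -[leLHS]qmulq1; have [[D1 _] _] := bb (b x).
    apply: le_trans (qmul_le2l _ D1) _; rewrite qmul_bigsup.
    apply: qbigsup_le => t; apply: (le_qbigsup (b t)).
    exact: (le_qbigsup x).
  move=> z z'; apply: qbigsup_mul2_le => x x'; rewrite qmulACA.
  have [_ D2] := dp; apply: le_trans (qmul_ler _ (D2 x x')) _.
  apply: qbigsup_mul_le => t.
  (* The weight e(w, b(t)) moves w' way below b(t); the directedness of the
     basis at b(t) then joins the two elements so obtained. *)
  have le_t w w' : way_below w w' ⊗ e w (b t) <= generated b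
      (way_below (b t) \o b) w'.
    apply: le_trans (way_below_mono _ _ _) _.
    by have [dt st] := bb (b t); exact: way_below_generated.
  rewrite qmul_pair.
  apply: le_trans (qmul_le2l _ (qmul_le (le_t _ _) (le_t _ _))) _.
  have [dt _] := bb (b t).
  apply: le_trans (qmul_le2l _ (generated_directed _ _ dt)) _.
  rewrite qmul_bigsup; apply: qbigsup_le => s; apply: (le_qbigsup (b s)).
  by rewrite !qmulA; do 2 apply: qmul_ler; exact: (le_qbigsup t).
change (fam_lsup id (fun y => ⋁_x (way_below p (b x) ⊗ way_below (b x) y)) p).
move/fam_lsupP: sp => [_ lubp].
apply/fam_lsupP; split=> [z|q c Hc].
  apply: qbigsup_le => x; rewrite qmulC.
  by apply: le_trans (lrel_trans z (b x) p);
    apply: qmul_le; exact: way_below_lrel.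
apply: lubp => x; have [_ /fam_lsupP[_]] := bb (b x); apply=> t.
rewrite qmulCA qmulA; apply: le_trans (Hc (b t)); apply: qmul_ler.
exact: (le_qbigsup x).
Qed.

(** Interpolating first provides two weights for each of y and y'; the
    directedness of the basis consumes one pair and leaves the other to move up
    to the common bound. *)
Lemma way_below_directed p y y' :
  way_below p y ⊗ way_below p y' <=
  ⋁_x (way_below p (b x) ⊗ way_below (b x) y ⊗ way_below (b x) y').
Proof.
apply: le_trans (qmul_le (way_below_interpolate p y)
  (way_below_interpolate p y')) _.
apply: qbigsup_mul2_le => x x'; rewrite qmulACA.
have [[_ D2] _] := bb p; apply: le_trans (qmul_ler _ (D2 x x')) _.
apply: qbigsup_mul_le => t; apply: (le_qbigsup t).
rewrite qmul_pair -[leRHS]qmulA.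
by apply: qmul_le2l; apply: qmul_le; exact: way_below_mono.
Qed.

End Basis.

End Families.

Section ScottFamilies.
Context {d : Order.disp_t} {L : quantaleType d}.
Variables P Q : lordered L.

(** Scott continuity, phrased with images in the codomain, transfers to
    families because images compose. *)
Lemma scott_fam_directed (f : P -> Q) (X : Type) (b : X -> P) (A : X -> L) :
  scott_continuous f -> fam_directed b A -> fam_directed (f \o b) A.
Proof.
by move=> sf /directed_limage/(scott_directed sf); rewrite -limage_comp
  => /directed_limage.
Qed.

Lemma scott_fam_lsup (f : P -> Q) (X : Type) (b : X -> P) (A : X -> L) p :
  scott_continuous f -> fam_directed b A -> fam_lsup b A p ->
  fam_lsup (f \o b) A (f p).
Proof.
move=> sf /directed_limage dA /is_lsup_limage/(sf _ _ dA).
by rewrite -limage_comp => /is_lsup_limage.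
Qed.

(** For the supremum x of D, e(f(x), q) = e(x, g(q)), and the latter is given
    by the supremum. *)
Lemma lrel_iso_scott (f : P -> Q) (g : Q -> P) :
  cancel g f -> (forall x y, lrel (f x) (f y) = lrel x y) ->
  scott_continuous f.
Proof.
move=> gK fe D x _ Dx; apply/is_lsup_limage => q.
rewrite -(gK q) fe Dx; congr qinf; apply: eq_imagel => z _.
by rewrite fe.
Qed.

End ScottFamilies.

(** * Rounded ideals *)

Section OnePoint.
Context {d : Order.disp_t} (L : quantaleType d).

(** The identity is a closure operator, and its value at the point is the
    unit. *)
Definition one_point_space : gclosure_space L :=
  @GClosureSpace d L unit (fun A => A) (fun _ _ => lexx _) (fun _ _ => lexx _).

Lemma lpoint_unit (s t : unit) : lpoint s t = qunit :> L.
Proof. by case: s t => -[]; exact: lpointxx. Qed.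

Lemma one_point_interpolative : interpolative one_point_space.
Proof.
split=> [x|x y|x a b] /=; apply: (le_qbigsup tt);
  by rewrite !lpoint_unit ?qmulq1.
Qed.

Definition one_point : igcs L := exist _ one_point_space one_point_interpolative.

End OnePoint.

Section RoundedIdeals.
Context {d : Order.disp_t} {L : quantaleType d}.
Variable X : igcs L.
Local Notation r := (@relid d L (sval X)).

(** Rounded ideals are global points. Being inhabited, closed under r, rounded and
    directed are [ap1], [ap3], [ap4] and [ap5] for a relation with a one-point
    domain. *)
Definition rideal := approx_rel (one_point L) X.

Definition rmem (I : rideal) : sval X -> L := sval I tt.

Lemma rmem_inhabited (I : rideal) : qunit <= ⋁_x (rmem I x).
Proof. exact: ap1 (svalP I) tt. Qed.

Lemma rmem_lower (I : rideal) x y : rmem I x ⊗ r x y <= rmem I y.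
Proof. exact: ap3 (svalP I) tt x y. Qed.

Lemma rmem_round (I : rideal) y : rmem I y = ⋁_x (rmem I x ⊗ r x y).
Proof.
have := relcomp_idl (svalP I).
by move=> /(congr1 (fun f => f tt y)).
Qed.

Lemma rmem_directed (I : rideal) x y :
  rmem I x ⊗ rmem I y <= ⋁_z (rmem I z ⊗ r z x ⊗ r z y).
Proof. exact: ap5 (svalP I) tt x y. Qed.

Lemma rideal_ext (I J : rideal) : rmem I =1 rmem J -> I = J.
Proof.
move=> IJ; apply/sval_inj/funext => -[]; apply/funext => x; exact: IJ.
Qed.

Lemma rideal_approximable (A : sval X -> L) :
  qunit <= ⋁_x (A x) ->
  (forall x y, A x ⊗ r x y <= A y) ->
  (forall y, A y <= ⋁_x (A x ⊗ r x y)) ->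
  (forall x y, A x ⊗ A y <= ⋁_z (A z ⊗ r z x ⊗ r z y)) ->
  @approximable d L (one_point_space L) (sval X) (fun=> A).
Proof.
move=> A1 A2 A3 A4; split=> //= [x x' y|x y].
  by rewrite lpoint_unit qmul1q.
apply: (le_qbigsup tt); rewrite lpoint_unit.
apply: le_trans (A3 y) _; apply: qbigsup_le => z; apply: (le_qbigsup z).
by rewrite qmul1q.
Qed.

Lemma principal_approximable x :
  @approximable d L (one_point_space L) (sval X) (fun=> r x).
Proof.
have [i1 i2 i3] := svalP X.
apply: rideal_approximable; [exact: i1| |exact: i2|exact: i3].
by move=> y z; exact: lcl_point_trans.
Qed.

Definition principal x : rideal := exist _ _ (principal_approximable x).

Definition rle (I J : rideal) : L := lsub (rmem I) (rmem J).

Lemma rle_antisym I J : qunit <= rle I J `&` rle J I -> I = J.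
Proof.
rewrite lexI => /andP[IJ JI]; apply: rideal_ext => x.
by apply: le_anti_eq; apply: lsub_unit.
Qed.

Definition Idl : lordered L := @LOrdered d L rideal rle
  (fun I => lsub_refl _) (fun I J K => lsub_trans _ _ _) rle_antisym.

Lemma rmem_principal (I : Idl) x : rmem I x <= lrel (principal x : Idl) I.
Proof. by apply/le_lsub => y; rewrite qmulC; exact: rmem_lower. Qed.

(** Inclusion of a union in K is inclusion of each member in K, to any
    degree. *)
Lemma union_fam_lsup (Y : Type) (b : Y -> Idl) (A : Y -> L) (J : Idl) :
  (forall x, rmem J x = ⋁_y (A y ⊗ rmem (b y) x)) -> fam_lsup b A J.
Proof.
move=> JE; apply/fam_lsupP; split=> [y|K c Ac].
  by apply/le_lsub => x; rewrite qmulC JE; exact: (le_qbigsup y).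
apply/le_lsub => x; rewrite JE; apply: qbigsup_mul_le => y.
rewrite qmulAC qmulC; apply: le_trans (lsub_mp (rmem (b y)) (rmem K) x).
exact: qmul_le2l.
Qed.

(** Directedness of the family moves two elements, taken from two members,
    into a common member, where directedness of that member applies. *)
Lemma union_approximable (Y : Type) (b : Y -> Idl) (A : Y -> L) :
  fam_directed b A ->
  @approximable d L (one_point_space L) (sval X)
    (fun=> fun x => ⋁_y (A y ⊗ rmem (b y) x)).
Proof.
move=> [D1 D2]; apply: rideal_approximable.
- apply: le_trans D1 _; apply: qbigsup_le => y; rewrite -[leLHS]qmulq1.
  apply: le_trans (qmul_le2l _ (rmem_inhabited (b y))) _.
  rewrite qmul_bigsup; apply: qbigsup_mono => x; exact: (le_qbigsup y).
- move=> x x'; apply: qbigsup_mul_le => y; apply: (le_qbigsup y).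
  by rewrite -qmulA; apply: qmul_le2l; exact: rmem_lower.
- move=> x; apply: qbigsup_le => y; rewrite rmem_round qmul_bigsup.
  apply: qbigsup_mono => x'; rewrite qmulA; apply: qmul_ler.
  exact: (le_qbigsup y).
- move=> x x'; apply: qbigsup_mul2_le => y y'; rewrite qmulACA.
  apply: le_trans (qmul_ler _ (D2 y y')) _; apply: qbigsup_mul_le => z.
  rewrite qmul_pair.
  apply: le_trans (qmul_le2l _ (qmul_le (lsub_mp _ _ _) (lsub_mp _ _ _))) _.
  apply: le_trans (qmul_le2l _ (rmem_directed (b z) x x')) _.
  rewrite qmul_bigsup; apply: qbigsup_mono => t; rewrite !qmulA.
  by do 2 apply: qmul_ler; exact: (le_qbigsup z).
Qed.

(** Suprema being unique, every directed supremum is the union. *)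
Lemma fam_lsup_union (Y : Type) (b : Y -> Idl) (A : Y -> L) (J : Idl) x :
  fam_directed b A -> fam_lsup b A J -> rmem J x = ⋁_y (A y ⊗ rmem (b y) x).
Proof.
move=> dA JA.
suff -> : J = exist _ _ (union_approximable dA) :> Idl by [].
by apply: (fam_lsup_uniq JA); exact: union_fam_lsup.
Qed.

Lemma Idl_dcpo : is_ldcpo Idl.
Proof.
move=> D dD; exists (exist _ _ (@union_approximable Idl id D dD)).
exact: (@union_fam_lsup Idl id).
Qed.

Lemma relid_principal x y :
  r x y <= lrel (principal y : Idl) (principal x).
Proof. exact: (rmem_principal (principal x)). Qed.

Lemma principal_directed (I : Idl) :
  fam_directed (principal : _ -> Idl) (rmem I).
Proof.
split=> [|x y]; first exact: rmem_inhabited.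
apply: le_trans (rmem_directed I x y) _; apply: qbigsup_mono => z.
by do 2?[apply: qmul_le]; rewrite ?relid_principal.
Qed.

Lemma principal_lsup (I : Idl) : fam_lsup (principal : _ -> Idl) (rmem I) I.
Proof. by apply: union_fam_lsup => y; exact: rmem_round. Qed.

(** If I is below the supremum of an ideal D of ideals, then x belongs to the
    union of D, hence to some K in D, and then D contains the principal ideal of
    x as a lower set. *)
Lemma principal_way_below (I : Idl) x :
  rmem I x <= way_below I (principal x : Idl).
Proof.
apply: le_way_below => D S [dD lD] SD.
apply: le_trans (lsub_mp (rmem I) (rmem S) x) _.
rewrite (@fam_lsup_union Idl id D S x) //; apply: qbigsup_le => K.
apply: le_trans (qmul_le2l _ (rmem_principal K x)) _; exact: lD.
Qed.

Lemma principal_basis : is_basis (principal : _ -> Idl).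
Proof.
apply: (@basis_of_families _ _ Idl _ _ principal id) => I.
by exists (rmem I); split;
  [exact: principal_directed|exact: principal_lsup|exact: principal_way_below].
Qed.

Lemma closure_space_algebraic : is_closure_space (sval X) -> is_algebraic Idl.
Proof.
move=> cX; apply: (compact_basis_algebraic principal_basis) => x.
apply: le_trans (principal_way_below (principal x) x).
by rewrite -(lpointxx x); exact: cX.
Qed.

End RoundedIdeals.

(** * The functor of rounded ideals *)

Section IdealFunctor.
Context {d : Order.disp_t} {L : quantaleType d}.

(** Suprema are unions, and composition with a relation preserves unions. *)
Lemma approx_rel_comp_scott (X Y : igcs L) (Θ : approx_rel X Y) :
  scott_continuous (approx_rel_comp Θ : Idl X -> Idl Y).
Proof.
move=> D J dD JD; apply/is_lsup_limage/union_fam_lsup => y.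
apply: le_anti_eq.
  apply: qbigsup_le => x.
  change (rmem J x ⊗ sval Θ x y <=
    ⋁_K (D K ⊗ rmem (approx_rel_comp Θ K) y)).
  rewrite (@fam_lsup_union _ _ X (Idl X) id D J x) //.
  apply: qbigsup_mul_le => K; apply: (le_qbigsup K); rewrite -qmulA.
  by apply: qmul_le2l; exact: (le_qbigsup x).
apply: qbigsup_le => K; rewrite /rmem /= /relcomp qmul_bigsup.
apply: qbigsup_mono => x; rewrite qmulA; apply: qmul_ler.
change (D K ⊗ rmem K x <= rmem J x).
rewrite (@fam_lsup_union _ _ X (Idl X) id D J x) //.
exact: (le_qbigsup K).
Qed.

Definition ideal_obj (X : obj (LIGCS L)) : obj (LCDOM L) :=
  exist _ (exist _ (Idl X) (@Idl_dcpo _ _ X))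
    (basis_continuous (@principal_basis _ _ X)).

Definition ideal_map (X Y : obj (LIGCS L)) (Θ : hom X Y) :
    hom (ideal_obj X) (ideal_obj Y) :=
  exist _ (approx_rel_comp Θ : Idl X -> Idl Y) (approx_rel_comp_scott Θ).

Lemma ideal_map_id X : ideal_map (idm X) = idm (ideal_obj X).
Proof. by apply/sval_inj/funext => I; exact: approx_rel_idl. Qed.

Lemma ideal_map_comp X Y Z (Υ : hom Y Z) (Θ : hom X Y) :
  ideal_map (compm Υ Θ) = compm (ideal_map Υ) (ideal_map Θ).
Proof.
by apply/sval_inj/funext => I; rewrite /= -approx_rel_assoc.
Qed.

Definition ideal_functor : functor (LIGCS L) (LCDOM L) :=
  Functor ideal_map_id ideal_map_comp.

(** Composing with a principal ideal returns a row of the relation, by the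
    right identity law. *)
Lemma ideal_map_inj X Y : injective (@ideal_map X Y).
Proof.
move=> Θ Υ /(congr1 sval) ΘΥ; apply/sval_inj/funext => x.
have /(congr1 (fun I => rmem I)) := congr1 (@^~ (principal x)) ΘΥ.
rewrite -(relcomp_idr (svalP Θ)) -(relcomp_idr (svalP Υ)); exact.
Qed.

(** I is the directed supremum of its principal ideals, and f preserves it. *)
Lemma scott_principal (X Y : igcs L) (f : Idl X -> Idl Y) (I : Idl X) y :
  scott_continuous f ->
  rmem (f I) y = ⋁_x (rmem I x ⊗ rmem (f (principal x)) y).
Proof.
move=> sf; apply: (@fam_lsup_union _ _ Y _ (f \o @principal _ _ X)).
  by apply: scott_fam_directed => //; exact: principal_directed.
by apply: scott_fam_lsup => //; [exact: principal_directed|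
  exact: principal_lsup].
Qed.

(** The rows f(r(x, -)) form an approximable relation: each row is a rounded
    ideal, the rows are monotone in x as f is, and the interpolation axiom
    [ap4] on the side of x is [scott_principal] at a principal ideal. *)
Lemma ideal_map_surj X Y (f : hom (ideal_obj X) (ideal_obj Y)) :
  exists Θ, ideal_map Θ = f.
Proof.
case: f => f /= sf.
pose Θ x y := rmem (f (principal x)) y.
have T2 x x' y : relid x' x ⊗ Θ x y <= Θ x' y.
  rewrite qmulC; apply: le_trans (lsub_mp (rmem (f (principal x))) _ y).
  apply: qmul_le2l; apply: le_trans (relid_principal _ _) _.
  exact: (scott_mono sf).
have aT : @approximable _ _ (sval X) (sval Y) Θ.
  split=> //= [x|x y y'|x y|x y y'].
  - exact: rmem_inhabited.
  - exact: rmem_lower.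
  - rewrite {1}/Θ scott_principal //; apply: qbigsup_mono => x'.
    rewrite (rmem_round (f _)) qmul_bigsup; apply: qbigsup_mono => y'.
    by rewrite qmulA.
  - exact: rmem_directed.
exists (exist _ Θ aT); apply/sval_inj/funext => I; apply: rideal_ext => y.
by rewrite (scott_principal I y sf).
Qed.

End IdealFunctor.

(** * Representing a domain by the ideals of a basis *)

Section ClosureOfRelation.
Context {d : Order.disp_t} {L : quantaleType d}.
Variables (X : Type) (r : X -> X -> L).
Hypothesis r_trans : forall x y z, r x y ⊗ r y z <= r x z.

(** Any transitive relation is realised as the point closures of this
    operator; other operators may give the same relation, and all of them
    define isomorphic objects. *)
Definition rel_cl (A : X -> L) : X -> L := fun y => ⋁_x (A x ⊗ r x y).

Lemma rel_cl_sub A B : lsub A B <= lsub (rel_cl A) (rel_cl B).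
Proof.
apply/le_lsub => y; apply: qbigsup_mul_le => x; apply: (le_qbigsup x).
by rewrite qmulAC; apply: qmul_ler; exact: lsub_mp.
Qed.

Lemma rel_cl_idem A y : rel_cl (rel_cl A) y <= rel_cl A y.
Proof.
apply: qbigsup_le => x; apply: qbigsup_mul_le => z; apply: (le_qbigsup z).
by rewrite -qmulA; exact: qmul_le2l.
Qed.

Definition rel_space : gclosure_space L := GClosureSpace rel_cl_sub rel_cl_idem.

Lemma relid_rel_space (x y : rel_space) : relid x y = r x y.
Proof. exact: (lpoint_sup (r^~ y)). Qed.

Lemma rel_space_closure :
  (forall x, qunit <= r x x) -> is_closure_space rel_space.
Proof.
move=> r1 A x; apply: (le_qbigsup x); rewrite -[leLHS]qmulq1.
exact: qmul_le2l.
Qed.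

End ClosureOfRelation.

Section Representation.
Context {d : Order.disp_t} {L : quantaleType d}.
Variables (P : lordered L) (T : Type) (b : T -> P).
Hypotheses (dP : is_ldcpo P) (bb : is_basis b).

Definition basis_space : gclosure_space L :=
  @rel_space _ _ T (fun x y => way_below (b x) (b y))
    (fun x y z => way_below_trans (b x) (b y) (b z)).

Lemma relid_basis (x y : basis_space) : relid x y = way_below (b x) (b y).
Proof. exact: relid_rel_space. Qed.

Lemma basis_space_interpolative : interpolative basis_space.
Proof.
split=> [x|x y|x y z].
- have [[D1 _] _] := bb (b x); apply: le_trans D1 _.
  by apply: qbigsup_mono => t; rewrite -/(relid _ _) relid_basis.
- rewrite -/(relid _ _) relid_basis.
  apply: le_trans (way_below_interpolate bb _ _) _.
  by apply: qbigsup_mono => t; rewrite -!/(relid _ _) !relid_basis.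
- rewrite -!/(relid _ _) !relid_basis.
  apply: le_trans (way_below_directed bb _ _ _) _.
  by apply: qbigsup_mono => t; rewrite -!/(relid _ _) !relid_basis.
Qed.

Definition basis_igcs : igcs L := exist _ _ basis_space_interpolative.

Lemma trace_approximable p :
  @approximable d L (one_point_space L) basis_space (fun=> way_below p \o b).
Proof.
apply: (@rideal_approximable _ _ basis_igcs).
- by have [[]] := bb p.
- by move=> x y; rewrite relid_basis; exact: way_below_trans.
- move=> y; apply: le_trans (way_below_interpolate bb _ _) _.
  by apply: qbigsup_mono => t; rewrite relid_basis.
- move=> x y; apply: le_trans (way_below_directed bb _ _ _) _.
  by apply: qbigsup_mono => t; rewrite !relid_basis.
Qed.

Definition trace (p : P) : Idl basis_igcs := exist _ _ (trace_approximable p).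

Lemma trace_lrel p q : lrel (trace p) (trace q) = lrel p q.
Proof.
have [_ /fam_lsupP[_ lub]] := bb p; apply: le_anti_eq.
  apply: lub => x; apply: le_trans (way_below_lrel q (b x)).
  exact: (lsub_mp (rmem (trace p)) (rmem (trace q)) x).
by apply/le_lsub => x; exact: way_below_mono.
Qed.

Lemma rideal_fam_directed (I : Idl basis_igcs) : fam_directed b (rmem I).
Proof.
split=> [|x y]; first exact: (rmem_inhabited I).
apply: le_trans (rmem_directed I x y) _; apply: qbigsup_mono => z.
rewrite !relid_basis.
by do 2?[apply: qmul_le] => //; exact: way_below_lrel.
Qed.

(** With s the supremum of I: anything way below s interpolates through some
    b(z) way below s, hence below some b(x) with x in I, and I is a lower set.
    Conversely, I is rounded, so each y in I has b(y) way below some b(x) with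
    x in I, and b(x) lies below s. *)
Lemma trace_lsup (I : Idl basis_igcs) s : fam_lsup b (rmem I) s -> trace s = I.
Proof.
move=> sI; apply: rideal_ext => y; apply: le_anti_eq.
  apply: le_trans (way_below_interpolate bb s (b y)) _.
  apply: qbigsup_le => z.
  apply: le_trans (qmul_ler _ (way_below_generated (b z)
    (rideal_fam_directed I) sI)) _.
  apply: qbigsup_mul_le => x; apply: le_trans (rmem_lower I x y).
  rewrite relid_basis -qmulA; apply: qmul_le2l; rewrite qmulC.
  exact: way_below_mono.
rewrite rmem_round; apply: qbigsup_le => x; rewrite relid_basis qmulC.
apply: le_trans (way_below_mono (b x) s (b y)); apply: qmul_le2l.
by move/fam_lsupP: sI => [ub _]; exact: ub.
Qed.

(** Taking traces preserves the order exactly and taking suprema inverts it, so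
    both maps are Scott continuous. *)
Lemma Idl_basis_iso : exists (f : Idl basis_igcs -> P) (g : P -> Idl basis_igcs),
  [/\ scott_continuous f, scott_continuous g, cancel f g & cancel g f].
Proof.
have /choice[f fP] : forall I : Idl basis_igcs, exists s, fam_lsup b (rmem I) s.
  by move=> I; exact: fam_lsup_exists (rideal_fam_directed I).
have fK : cancel f trace by move=> I; exact: trace_lsup.
have gK : cancel trace f.
  by move=> p; apply: (fam_lsup_uniq (fP _)); have [] := bb p.
exists f, trace; split=> //; last exact: lrel_iso_scott fK trace_lrel.
by apply: (lrel_iso_scott gK) => I J; rewrite -trace_lrel !fK.
Qed.

End Representation.

(** * The two equivalences *)

Section Equivalence.
Context {d : Order.disp_t} {L : quantaleType d}.

Lemma ideal_functor_ess_surj (P : obj (LCDOM L)) (T : Type)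
    (b : T -> sval (sval P)) (bb : is_basis b) :
  exists (i : hom (ideal_obj (basis_igcs bb)) P)
         (j : hom P (ideal_obj (basis_igcs bb))),
    compm j i = idm (ideal_obj (basis_igcs bb)) /\ compm i j = idm P.
Proof.
have [f [g [sf sg fK gK]]] := Idl_basis_iso (svalP (sval P)) bb.
exists (exist _ f sf), (exist _ g sg).
by split; apply/sval_inj/funext => x /=; [exact: fK|exact: gK].
Qed.

Definition algebraic_ideal_obj (X : obj (LCS L)) : obj (LAlgDOM L) :=
  exist _ (ideal_obj (sval X)) (closure_space_algebraic (svalP X)).

Definition algebraic_ideal_functor : functor (LCS L) (LAlgDOM L) :=
  @Functor (LCS L) (LAlgDOM L) algebraic_ideal_obj
    (fun X Y Θ => @ideal_map _ _ (sval X) (sval Y) Θ)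
    (fun X => ideal_map_id (sval X))
    (fun X Y Z Υ Θ => @ideal_map_comp _ _ (sval X) (sval Y) (sval Z) Υ Θ).

(** The reflexivity r(k, k) >= u is the compactness of k. *)
Lemma compact_space_closure (P : lordered L)
    (bb : is_basis (sval : {k : P | compact_elt k} -> P)) :
  is_closure_space (sval (basis_igcs bb)).
Proof. by apply: rel_space_closure => -[]. Qed.

End Equivalence.

Theorem theorem5p9 (d : Order.disp_t) (L : quantaleType d) :
  equivalent_categories (LIGCS L) (LCDOM L) /\
  equivalent_categories (LCS L) (LAlgDOM L).
Proof.
split.
  apply: (@equivalence_of_fully_faithful _ _ ideal_functor).
  - exact: ideal_map_surj.
  - exact: ideal_map_inj.
  - move=> P; have cP : is_basis (@id (sval (sval P))) := svalP P.
    by exists (basis_igcs cP); exact: ideal_functor_ess_surj.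
apply: (@equivalence_of_fully_faithful _ _ algebraic_ideal_functor).
- by move=> X Y; exact: ideal_map_surj.
- by move=> X Y; exact: ideal_map_inj.
- move=> P; have /algebraicP aP := svalP P.
  exists (exist _ (basis_igcs aP) (@compact_space_closure _ _ _ aP)).
  exact: ideal_functor_ess_surj.
Qed.
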